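(* Let $A\subset\mathbb{R}$ be a finite set. Then \[ \left|\left\{ \frac{ac-db}{c-d} : a,b,c,d\in A,\ c\neq d\right\}\right| \gg |A|^{2+1/14}. \]
   Context: The notation $X\gg Y$ means $X\ge cY$ for an absolute constant $c>0$.
   Formalization: The formal theorem assumes that A does not have exactly one element; for |A| = 1 there is no pair c ≠ d, the set is empty, and the stated lower bound fails. *)

(* Defs.v *)
From mathcomp Require Export all_boot all_order all_algebra finmap.
From mathcomp Require Export reals exp.

Set Implicit Arguments.
Unset Strict Implicit.
Unset Printing Implicit Defensive.

Import Order.TTheory GRing.Theory Num.Theory.
Local Open Scope ring_scope.
Local Open Scope fset_scope.

(* Here p = (a, b) and q = (c, d). *)
Definition quotient_set (R : realType) (A : {fset R}) : {fset R} :=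
  [fset (p.1 * q.1 - q.2 * p.2) / (q.1 - q.2)
     | p in A `*` A, q in [fset q in A `*` A | q.1 != q.2]].

Lemma quotient_setP (R : realType) (A : {fset R}) (x : R) :
  reflect (exists a b c d : R,
             [/\ a \in A, b \in A, c \in A & d \in A] /\
             c != d /\ x = (a * c - d * b) / (c - d))
          (x \in quotient_set A).
Proof.
apply: (iffP (imfset2P _ _ _ _ _)) => /=.
- move=> [[a b] + [[c d]]] /=; rewrite !inE /=.
  move=> /andP[aA bA] /andP[/andP[cA dA] cd] ->.
  by exists a, b, c, d.
- move=> [a [b [c [d [[aA bA cA dA] [cd ->]]]]]].
  exists (a, b); first by rewrite !inE /= aA.
  by exists (c, d) => //; rewrite !inE /= cA dA.
Qed.

(* Main.v *)
Require Import Defs.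
From mathcomp Require Import zify ring lra.
Set Implicit Arguments.
Unset Strict Implicit.
Unset Printing Implicit Defensive.
Import Order.TTheory GRing.Theory Num.Theory.

(* We may assume that 0 is not in A; put N = |A|. The line through two points
   (c, b) and (d, a) of A x A meets both coordinate axes at elements of the
   quotient set Q. Writing the line as X x + Y y = 1, both X and Y lie in the set
   G of inverses of nonzero elements of Q, and duality turns the points (c, b)
   into N^2 lines c X + b Y = 1, seen as affine maps X |-> Y. Since A x A spans
   on the order of N^4 lines (Beck), these N^2 affine maps have >> N^4 incidences
   with G x G. By Cauchy-Schwarz over Y, the N^4 compositions g = l'^-1 o l have
   >> N^8 / |G| incidences with G x G, and a Szemeredi-Trotter bound weighted by
   the energy E of the N^2 maps gives N^20 << E |G|^7. A second use of the
   incidence bound, on A x A, gives E << N^(11/2), hence N^29 << |G|^14.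

   The incidence bound is only needed for grids X x Y, where it has an elementary
   proof: cut the grid into s x s cells by rank; a line meets at most 2s cells,
   so a line with i >= 4s points contains >> i^2 / s pairs of distinct points
   lying in a common cell, and each such pair determines the line. *)

(** * Cauchy-Schwarz and counting over fibres *)

(** After doubling and symmetrising, the double sums compare termwise by [2 x y <= x^2 + y^2] with
    [x = f i g j] and [y = f j g i]. *)
Lemma Cauchy_sum_nat (I : Type) (r : seq I) (f g : I -> nat) :
  (\sum_(i <- r) f i * g i) ^ 2 <=
  (\sum_(i <- r) f i ^ 2) * (\sum_(i <- r) g i ^ 2).
Proof.
rewrite -(leq_pmul2l (isT : 0 < 2)) -mulnn !big_distrlr /=.
have -> : 2 * (\sum_(i <- r) \sum_(j <- r) f i ^ 2 * g j ^ 2) =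
  \sum_(i <- r) \sum_(j <- r) (f i ^ 2 * g j ^ 2 + f j ^ 2 * g i ^ 2).
  rewrite mul2n -addnn {2}exchange_big -big_split /=.
  by apply: eq_bigr => i _; rewrite -big_split.
rewrite big_distrr; apply: leq_sum => i _ /=.
rewrite big_distrr; apply: leq_sum => j _ /=.
rewrite -!expnMn; apply: leq_trans (nat_Cauchy _ _).
by rewrite leq_mul2l /=; lia.
Qed.

Lemma Cauchy_sum1_nat (I : Type) (r : seq I) (f : I -> nat) :
  (\sum_(i <- r) f i) ^ 2 <= size r * \sum_(i <- r) f i ^ 2.
Proof.
have := Cauchy_sum_nat r (fun=> 1) f.
by rewrite sum1_size; under eq_bigr do rewrite mul1n.
Qed.

Lemma sum_eqr_uniq (T : eqType) (K : seq T) (u : T) (h : T -> nat) :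
  uniq K -> u \in K -> \sum_(k <- K) (u == k) * h k = h u.
Proof.
move=> uK Ku; rewrite (bigD1_seq u) //= eqxx mul1n big1 ?addn0 // => k.
by rewrite eq_sym => /negPf ->.
Qed.

Lemma sum_fibers (I : eqType) (T : eqType) (r : seq I) (K : seq T)
    (f : I -> T) (h : T -> nat) :
  uniq K -> {in r, forall i, f i \in K} ->
  \sum_(i <- r) h (f i) = \sum_(k <- K) (\sum_(i <- r) (f i == k)) * h k.
Proof.
move=> uK fK; under [RHS]eq_bigr do rewrite big_distrl /=.
rewrite exchange_big /= big_seq [RHS]big_seq; apply: eq_bigr => i /fK fi.
by rewrite sum_eqr_uniq.
Qed.

(** Both sides count pairs of indices with equal values, the energy of [f]. *)
Lemma sum_fibers_sqr (I : eqType) (T : eqType) (r : seq I) (K : seq T)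
    (f : I -> T) :
  uniq K -> {in r, forall i, f i \in K} ->
  \sum_(k <- K) (\sum_(i <- r) (f i == k)) ^ 2 =
  \sum_(i <- r) \sum_(j <- r) (f i == f j).
Proof.
move=> uK fK; rewrite (sum_fibers (fun k => \sum_(j <- r) (k == f j)) uK fK).
apply: eq_bigr => k _; rewrite -mulnn; congr (_ * _).
by apply: eq_bigr => j _; rewrite eq_sym.
Qed.

Lemma sum_rel_pred (I : eqType) (r : seq I) (P : pred I) :
  \sum_(i <- r) P i = count P r.
Proof. by rewrite -sum1_count [RHS]big_mkcond; apply: eq_bigr => i _; case: (P i). Qed.

Lemma sum_const_seq (I : Type) (r : seq I) (k : nat) :
  \sum_(i <- r) k = size r * k.
Proof. by rewrite big_const_seq iter_addn_0 count_predT mulnC. Qed.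

Lemma size_sqr_fibers (I : eqType) (T : eqType) (r : seq I) (K : seq T)
    (f : I -> T) :
  uniq K -> {in r, forall i, f i \in K} ->
  size r ^ 2 <= size K * \sum_(i <- r) \sum_(j <- r) (f i == f j).
Proof.
move=> uK fK; rewrite -(sum_fibers_sqr uK fK).
have -> : size r = \sum_(k <- K) \sum_(i <- r) (f i == k).
  rewrite -sum1_size (sum_fibers (fun=> 1) uK fK).
  by apply: eq_bigr => k _; rewrite muln1.
exact: Cauchy_sum1_nat.
Qed.

Lemma sum_eq_uniq (T : eqType) (s : seq T) (x : T) :
  uniq s -> \sum_(y <- s) (y == x) = (x \in s).
Proof. by move=> us; rewrite sum_rel_pred -(count_uniq_mem x us). Qed.

(** * Ranks and blocks of consecutive elements *)

(** Position in increasing order, without sorting; [rank X x %/ w] indexes the block of [w]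
    consecutive elements containing [x]. *)
Definition rank (R : realDomainType) (X : seq R) (x : R) : nat :=
  count (fun y => (y < x)%R) X.

Lemma rank_le (R : realDomainType) (X : seq R) (x y : R) :
  (x <= y)%R -> rank X x <= rank X y.
Proof. by move=> xy; apply: sub_count => z /= /lt_le_trans; apply. Qed.

Lemma rank_lt_size (R : realDomainType) (X : seq R) (x : R) :
  x \in X -> rank X x < size X.
Proof.
move=> xX; rewrite -(count_predC (fun y => (y < x)%R) X) -addn1 leq_add2l.
by rewrite -has_count; apply/hasP; exists x => //=; rewrite ltxx.
Qed.

Lemma rank_lt (R : realDomainType) (X : seq R) (x y : R) :
  x \in X -> (x < y)%R -> rank X x < rank X y.
Proof.
move=> xX xy; rewrite /rank -addn1.
have x1 : 0 < count (pred1 x) X by rewrite -has_count has_pred1.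
apply: leq_trans (leq_add (leqnn _) x1) _.
rewrite -count_predUI [X in _ + X](_ : _ = 0) ?addn0.
  by apply: sub_count => z /= /orP[zx|/eqP ->] //; apply: lt_trans xy.
apply/eqP; rewrite -leqn0 leqNgt -has_count; apply/hasPn => z _ /=.
by case: eqP => [->|_]; rewrite ?ltxx ?andbF.
Qed.

Lemma rank_inj (R : realDomainType) (X : seq R) :
  {in X &, injective (rank X)}.
Proof.
move=> x y xX yX xy; case: (ltgtP x y) => // [/(rank_lt xX)|/(rank_lt yX)];
by rewrite xy ltnn.
Qed.

Lemma rank_block (R : realDomainType) (X : seq R) (w j : nat) :
  uniq X -> 0 < w -> \sum_(x <- X) (rank X x %/ w == j) <= w.
Proof.
move=> uX w0; rewrite sum_rel_pred -size_filter -(size_map (rank X)).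
rewrite -[leqRHS](size_iota (j * w)); apply: uniq_leq_size.
  rewrite map_inj_in_uniq ?filter_uniq // => x y.
  by rewrite !mem_filter => /andP[_ xX] /andP[_ yX]; apply: rank_inj.
move=> k /mapP[x]; rewrite mem_filter mem_iota => /andP[/eqP <- _] ->.
by rewrite leq_divM /= -mulSnr ltn_ceil.
Qed.

(** * Incidences of lines with a grid *)

Definition line_at (R : realFieldType) (l : R * R) (x : R) : R :=
  (l.1 * x + l.2)%R.

Definition incidences (R : realFieldType) (X Y : seq R) (l : R * R) : nat :=
  \sum_(x <- X) (line_at l x \in Y).

(** Cauchy-Schwarz over the at most [2 * s] cells that the line meets. *)
Lemma line_cells (R : realFieldType) (X Y : seq R) (n s w : nat) (l : R * R) :
  size X <= n -> size Y <= n -> 0 < w -> n < s * w ->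
  (incidences X Y l) ^ 2 <= 2 * s *
    \sum_(x <- [seq x <- X | (line_at l x \in Y)])
    \sum_(y <- [seq x <- X | (line_at l x \in Y)])
      ((rank X x %/ w == rank X y %/ w) &&
       (rank Y (line_at l x) %/ w == rank Y (line_at l y) %/ w)).
Proof.
move=> Xn Yn w0 nsw; set XL := filter _ _.
pose b x := rank Y (line_at l x) %/ w.
(* The cells met by a line form a chain, so they are told apart by phi. *)
pose phi x := rank X x %/ w + (if (0 <= l.1)%R then b x else s - b x).
have small (Z : seq R) z : size Z <= n -> z \in Z -> rank Z z %/ w < s.
  move=> Zn zZ; rewrite ltn_divLR //; apply: leq_ltn_trans nsw.
  exact: leq_trans (ltnW (rank_lt_size zZ)) Zn.
have bs x : x \in XL -> b x < s.
  by rewrite mem_filter => /andP[xY _]; apply: small.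
have phiK : {in XL, forall x, phi x \in iota 0 (2 * s)}.
  move=> x xXL; rewrite mem_iota add0n /=; have := bs _ xXL.
  have : rank X x %/ w < s.
    by apply: small => //; move: xXL; rewrite mem_filter => /andP[].
  by rewrite /phi; case: ifP; lia.
have -> : incidences X Y l = \sum_(k <- iota 0 (2 * s)) \sum_(x <- XL) (phi x == k).
  have := sum_fibers (fun=> 1) (iota_uniq 0 (2 * s)) phiK.
  rewrite sum1_size size_filter /incidences sum_rel_pred => ->.
  by apply: eq_bigr => k _; rewrite muln1.
apply: leq_trans (Cauchy_sum1_nat _ _) _.
rewrite size_iota leq_mul2l; apply/orP; right.
rewrite (sum_fibers_sqr (iota_uniq _ _) phiK).
rewrite big_seq [leqRHS]big_seq; apply: leq_sum => x xL.
rewrite big_seq [leqRHS]big_seq; apply: leq_sum => y yL.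
case: eqP => // phixy; rewrite lt0b.
have [bx by'] := (bs _ xL, bs _ yL).
suff: rank X x %/ w = rank X y %/ w /\ b x = b y.
  by rewrite /b => -[-> ->]; rewrite !eqxx.
(* Both summands of [phi] are weakly increasing in [x], so equal sums force equal summands; [b < s]
   keeps the truncated [s - b] injective. *)
clear xL yL; wlog xy : x y phixy bx by' / (x <= y)%R.
  by move=> H; case/orP: (le_total x y) => /H [] // -> ->.
have axy : rank X x %/ w <= rank X y %/ w by rewrite leq_div2r ?rank_le.
move: phixy; rewrite /phi; case: ifPn => [l0|].
  have : b x <= b y by rewrite leq_div2r // rank_le // /line_at lerD2r ler_wpM2l.
  lia.
rewrite -ltNge => l0.
have : b y <= b x by rewrite leq_div2r // rank_le // /line_at lerD2r ler_wnM2l // ltW.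
lia.
Qed.

Lemma line_through (R : realFieldType) (x y : R) (l l' : R * R) :
  x != y -> line_at l x = line_at l' x ->
  line_at l y = line_at l' y -> l = l'.
Proof.
case: l l' => [m k] [m' k']; rewrite /line_at /= => xy ex ey.
have : ((m - m') * (x - y) = 0)%R by lra.
move/eqP; rewrite mulf_eq0 [(x - y == _)%R]subr_eq0 (negPf xy) orbF subr_eq0.
by move/eqP => mm; congr pair => //; move: ex; rewrite mm => /addrI.
Qed.

(** The values at [x] and [y] determine the line: at most [n] choices for the first, then at most
    [w] in its block for the second. *)
Lemma lines_through_pair (R : realFieldType) (Y : seq R) (n w : nat)
    (L : seq (R * R)) (x y : R) :
  uniq Y -> size Y <= n -> 0 < w -> uniq L -> x != y ->
  \sum_(l <- L) [&& line_at l x \in Y, line_at l y \in Y &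
    rank Y (line_at l x) %/ w == rank Y (line_at l y) %/ w] <= n * w.
Proof.
move=> uY Yn w0 uL xy; rewrite sum_rel_pred.
pose f (l : R * R) := (line_at l x, line_at l y).
pose S := [seq p <- [seq (u, v) | u <- Y, v <- Y] |
             rank Y p.1 %/ w == rank Y p.2 %/ w].
apply: (@leq_trans (size S)).
  rewrite -size_filter -(size_map f); apply: uniq_leq_size.
    rewrite map_inj_uniq ?filter_uniq // => l l' [ex ey].
    exact: (line_through xy).
  move=> p /mapP[l]; rewrite mem_filter => /andP[/and3P[lx ly e] _] ->.
  by rewrite mem_filter e; apply: allpairs_f.
rewrite size_filter -sum_rel_pred big_allpairs.
apply: (@leq_trans (\sum_(u <- Y) w)); last first.
  by rewrite sum_const_seq leq_mul2r Yn orbT.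
apply: leq_sum => u _.
by under eq_bigr do rewrite /= eq_sym; apply: rank_block.
Qed.

Lemma incidences_le (R : realFieldType) (X Y : seq R) (l : R * R) :
  incidences X Y l <= size X.
Proof. by rewrite /incidences sum_rel_pred count_size. Qed.

(* The second moment over rich lines replaces the usual count of k-rich lines and
   avoids dyadic summation. *)
Lemma rich_lines (R : realFieldType) (X Y : seq R) (n s : nat)
    (L : seq (R * R)) :
  uniq X -> uniq Y -> size X <= n -> size Y <= n -> 0 < s -> uniq L ->
  {in L, forall l, 4 * s <= incidences X Y l} ->
  s * \sum_(l <- L) incidences X Y l ^ 2 <= 16 * n ^ 4.
Proof.
move=> uX uY Xn Yn s0 uL rich.
have [->|[l0 l0L]] : L = [::] \/ exists l, l \in L.
- by case: (L) => [|l L']; [left|right; exists l; rewrite mem_head].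
- by rewrite big_nil muln0.
have sn : s <= n.
  have := leq_trans (rich _ l0L) (leq_trans (incidences_le X Y l0) Xn); lia.
(* This width gives [n < s * w <= 2 * n]; the upper bound uses [s <= n]. *)
pose w := (n %/ s).+1.
have nsw : n < s * w by rewrite mulnC; apply: ltn_ceil.
have sw : s * w <= 2 * n by rewrite mulnS; have := leq_divM n s; lia.
pose T (l : R * R) := \sum_(x <- X) \sum_(y <- X)
  ((x != y) && (rank X x %/ w == rank X y %/ w)) *
  [&& line_at l x \in Y, line_at l y \in Y &
    rank Y (line_at l x) %/ w == rank Y (line_at l y) %/ w].
(* The pairs with [x = y] contribute [2 * s * i], at most half of [i ^ 2] since [4 * s <= i], and
   are absorbed. *)
have iT l : l \in L -> incidences X Y l ^ 2 <= 4 * s * T l.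
  move=> lL; have := @line_cells R X Y n s w l Xn Yn isT nsw.
  set S := (\sum_(x <- _) _); have rl := rich l lL.
  suff ST : S <= incidences X Y l + T l.
    set i := incidences X Y l in rl ST *; rewrite -!mulnn => iS.
    have : 2 * s * S <= 2 * s * (i + T l) by rewrite leq_mul2l ST orbT.
    have : 4 * s * i <= i * i by rewrite leq_mul2r rl orbT.
    lia.
  rewrite /S big_filter /T /incidences big_mkcond -big_split /=.
  apply: leq_sum => x _; case: ifP => //= xY.
  rewrite big_filter big_mkcond /=.
  apply: (@leq_trans (\sum_(y <- X) ((y == x) +
    ((x != y) && (rank X x %/ w == rank X y %/ w)) *
    ((line_at l y \in Y) && (rank Y (line_at l x) %/ w ==
      rank Y (line_at l y) %/ w))))).
    apply: leq_sum => y _; case: ifP => //= yY.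
    rewrite [x == y]eq_sym; case: (y == x) => /=; first by case: andb.
    by rewrite mulnb.
  rewrite big_split leq_add2r /= sum_rel_pred.
  by rewrite (@count_uniq_mem _ X x uX); case: (x \in X).
(* Choose [x], then [y] in its block, then a line through two points over them in a common cell:
   [n], [w] and [n * w] choices. *)
have ST : \sum_(l <- L) T l <= (n * w) ^ 2.
  rewrite /T exchange_big /=.
  apply: (@leq_trans (\sum_(x <- X) (w * (n * w)))); last first.
    by rewrite sum_const_seq mulnA -mulnn leq_mul2r leq_mul2r Xn !orbT.
  apply: leq_sum => x _; rewrite exchange_big /=.
  apply: (@leq_trans (\sum_(y <- X) (rank X y %/ w == rank X x %/ w) * (n * w))).
    apply: leq_sum => y _; rewrite -big_distrr /= [in leqRHS]eq_sym.
    case: (altP (x =P y)) => //= xy; rewrite leq_mul2l.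
    by rewrite (lines_through_pair uY Yn _ uL xy) ?orbT.
  by rewrite -big_distrl /= leq_mul2r rank_block ?orbT.
have : \sum_(l <- L) incidences X Y l ^ 2 <= 4 * s * (n * w) ^ 2.
  apply: leq_trans (leq_mul (leqnn _) ST); rewrite big_distrr /=.
  by rewrite big_seq [leqRHS]big_seq; apply: leq_sum => l /iT.
move=> H; apply: leq_trans (leq_mul (leqnn s) H) _.
have -> : s * (4 * s * (n * w) ^ 2) = 4 * n ^ 2 * (s * w) ^ 2 by ring.
have -> : 16 * n ^ 4 = 4 * n ^ 2 * (2 * n) ^ 2 by ring.
by rewrite leq_mul2l leq_sqr sw orbT.
Qed.

Lemma sum_incidences_sqr (R : realFieldType) (X Y : seq R) (n s : nat)
    (L : seq (R * R)) :
  uniq X -> uniq Y -> size X <= n -> size Y <= n -> 0 < s -> uniq L ->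
  s * \sum_(l <- L) incidences X Y l ^ 2 <=
  4 * s ^ 2 * (\sum_(l <- L) incidences X Y l) + 16 * n ^ 4.
Proof.
move=> uX uY Xn Yn s0 uL.
pose rich l := 4 * s <= incidences X Y l.
rewrite (bigID rich) /= mulnDr addnC leq_add //.
  rewrite (_ : 4 * s ^ 2 = s * (4 * s)); last by ring.
  rewrite -mulnA leq_mul2l; apply/orP; right.
  rewrite big_distrr big_mkcond /=; apply: leq_sum => l _.
  case: ifP => //; rewrite /rich -ltnNge => /ltnW poor.
  by rewrite -mulnn leq_mul2r poor orbT.
rewrite -[\sum_(l <- L | _) _]big_filter; apply: rich_lines; rewrite ?filter_uniq // => l.
by rewrite mem_filter => /andP[].
Qed.

(** Here [m] is the contribution of the rich lines, with multiplicity. Cauchy-Schwarz separates the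
    squared multiplicities, whose sum is the energy, from the second moment over rich lines. *)
Lemma weighted_incidences (R : realFieldType) (I : eqType) (r : seq I)
    (g : I -> R * R) (X Y : seq R) (n s : nat) :
  uniq X -> uniq Y -> size X <= n -> size Y <= n -> 0 < s ->
  exists2 m, \sum_(i <- r) incidences X Y (g i) <= 4 * s * size r + m &
    s * m ^ 2 <= (\sum_(i <- r) \sum_(j <- r) (g i == g j)) * (16 * n ^ 4).
Proof.
move=> uX uY Xn Yn s0; pose K := undup (map g r).
have uK : uniq K by apply: undup_uniq.
have gK : {in r, forall i, g i \in K}.
  by move=> i ir; rewrite mem_undup map_f.
pose w l := \sum_(i <- r) (g i == l).
pose rich l := 4 * s <= incidences X Y l.
exists (\sum_(l <- K | rich l) w l * incidences X Y l).
  rewrite (sum_fibers (incidences X Y) uK gK) (bigID rich) /= addnC leq_add //.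
  have -> : size r = \sum_(l <- K) w l.
    rewrite -sum1_size (sum_fibers (fun=> 1) uK gK).
    by apply: eq_bigr => k _; rewrite muln1.
  rewrite big_distrr big_mkcond /=; apply: leq_sum => l _.
  case: ifP => //; rewrite /rich -ltnNge => /ltnW poor.
  by rewrite mulnC leq_mul2r poor orbT.
rewrite -(sum_fibers_sqr uK gK) -[\sum_(l <- K | _) _]big_filter.
apply: leq_trans (leq_mul (leqnn s) (Cauchy_sum_nat _ _ _)) _.
rewrite mulnCA; apply: leq_mul.
  by rewrite big_filter [leqRHS](bigID rich) /= leq_addr.
apply: rich_lines; rewrite ?filter_uniq // => l.
by rewrite mem_filter => /andP[].
Qed.

(** * Energy of the composed affine maps *)

Definition pairs (T U : Type) (s : seq T) (t : seq U) : seq (T * U) :=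
  [seq (x, y) | x <- s, y <- t].

Lemma size_pairs (T U : Type) (s : seq T) (t : seq U) :
  size (pairs s t) = size s * size t.
Proof. exact: size_allpairs. Qed.

Lemma sum_pairs (T U : Type) (s : seq T) (t : seq U) (F : T * U -> nat) :
  \sum_(p <- pairs s t) F p = \sum_(x <- s) \sum_(y <- t) F (x, y).
Proof. exact: big_allpairs. Qed.

Lemma pairs_uniq (T U : eqType) (s : seq T) (t : seq U) :
  uniq s -> uniq t -> uniq (pairs s t).
Proof. by move=> us ut; apply: allpairs_uniq => // -[x y] [x' y']. Qed.

(* [transfer (b, b', c', c)] is the affine map sending X to the solution X' of
   (1 - c X) / b = (1 - c' X') / b', given by its slope and intercept; [cross] is
   its intercept, which does not involve c. *)
Definition cross (R : realFieldType) (t : R * R * R) : R :=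
  (t.1.1 - t.1.2) / (t.1.1 * t.2).

Definition transfer (R : realFieldType) (k : R * R * R * R) : R * R :=
  ((k.1.1.2 * k.2) / (k.1.1.1 * k.1.2), cross k.1)%R.

(* For fixed b and z, [cross (b, b', c) == z] says that (c, b') lies on the line
   of slope - b z and intercept b. *)
Lemma cross_energy (R : realFieldType) (A : seq R) (s : nat) :
  uniq A -> 0%R \notin A -> 0 < s -> s ^ 2 <= size A ->
  s * \sum_(t <- pairs (pairs A A) A) \sum_(t' <- pairs (pairs A A) A)
        (cross t == cross t')
  <= 20 * size A ^ 5.
Proof.
move=> uA A0 s0 sA; set N := size A in sA *; set r := pairs _ _.
pose Z := undup (map (@cross R) r).
have uZ : uniq Z by apply: undup_uniq.
have cZ : {in r, forall t, cross t \in Z}.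
  by move=> t tr; rewrite mem_undup map_f.
pose l (b z : R) : R * R := (- (b * z), b)%R.
have nz x : x \in A -> x != 0%R by apply: contraTneq => ->.
have fib z : \sum_(t <- r) (cross t == z) = \sum_(b <- A) incidences A A (l b z).
  rewrite /r sum_pairs sum_pairs big_seq [RHS]big_seq; apply: eq_bigr => b bA.
  rewrite exchange_big /= big_seq [RHS]big_seq; apply: eq_bigr => c cA.
  rewrite -(sum_eq_uniq _ uA); apply: eq_bigr => b' _; congr nat_of_bool.
  have [b0 c0] := (nz _ bA, nz _ cA).
  rewrite /cross /line_at /=; by apply/eqP/eqP => [<-|->]; field; rewrite ?b0 ?c0.
rewrite -(sum_fibers_sqr uZ cZ).
pose L := [seq l b z | z <- Z, b <- A].
have sL (F : R * R -> nat) :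
  \sum_(k <- L) F k = \sum_(z <- Z) \sum_(b <- A) F (l b z).
  by rewrite big_allpairs_dep.
have uL : uniq L.
  apply: allpairs_uniq => // -[z b] [z' b'].
  move=> /allpairsP[[z1 b1] /= [_ b1A [_ ->]]] _ [e1 e2].
  by move: e1; rewrite -e2 => /oppr_inj /(mulfI (nz _ b1A)) ->.
(* Each triple [(b, b', c)] is counted once, at [z = cross (b, b', c)]. *)
have LN : \sum_(k <- L) incidences A A k = N ^ 3.
  rewrite sL; under eq_bigr do rewrite -fib.
  have := sum_fibers (fun=> 1) uZ cZ; rewrite sum1_size !size_pairs.
  under [in X in _ = X -> _]eq_bigr do rewrite muln1.
  by move=> <-; rewrite -/N; ring.
apply: (@leq_trans (s * (N * \sum_(k <- L) incidences A A k ^ 2))).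
  rewrite leq_mul2l sL big_distrr /=; apply/orP; right.
  by apply: leq_sum => z _; rewrite fib; apply: Cauchy_sum1_nat.
rewrite mulnCA.
(* Since [s ^ 2 <= N], the first error term is at most [4 * N ^ 4]; with [16 * N ^ 4] this gives the
   constant 20. *)
have := sum_incidences_sqr uA uA (leqnn N) (leqnn N) s0 uL.
rewrite LN => H; apply: leq_trans (leq_mul (leqnn N) H) _.
have -> : 20 * N ^ 5 = N * (4 * N * N ^ 3 + 16 * N ^ 4) by ring.
rewrite leq_mul2l; apply/orP; right.
by rewrite leq_add2r leq_mul2r leq_mul2l sA !orbT.
Qed.

(** Equal maps have equal intercepts, that is, equal [cross]; equality of slopes then determines [c]
    from [c'], leaving [size A] choices. *)
Lemma transfer_energy (R : realFieldType) (A : seq R) :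
  uniq A -> 0%R \notin A ->
  \sum_(k <- pairs (pairs (pairs A A) A) A)
    \sum_(k' <- pairs (pairs (pairs A A) A) A) (transfer k == transfer k')
  <= size A * \sum_(t <- pairs (pairs A A) A) \sum_(t' <- pairs (pairs A A) A)
        (cross t == cross t').
Proof.
move=> uA A0; set r := pairs (pairs A A) A.
have nz x : x \in A -> x != 0%R by apply: contraTneq => ->.
have nzr t : t \in r -> [/\ t.1.1 != 0, t.1.2 != 0 & t.2 != 0]%R.
  case/allpairsP => -[p c] /= [/allpairsP[[b b'] /= [bA b'A ->]] cA ->].
  by split; apply: nz.
rewrite sum_pairs big_distrr /= big_seq [leqRHS]big_seq; apply: leq_sum => t tr.
under eq_bigr do rewrite sum_pairs.
rewrite exchange_big big_distrr /= big_seq [leqRHS]big_seq.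
apply: leq_sum => t' t'r; rewrite exchange_big /=.
rewrite -sum_const_seq; apply: leq_sum => c' _.
case: (altP (cross t =P cross t')) => [e|ne]; last first.
  rewrite big1 // => c _; rewrite xpair_eqE /= (negPf ne) andbF //.
pose d := (t'.1.2 * c' / (t'.1.1 * t'.2) * (t.1.1 * t.2) / t.1.2)%R.
apply: (@leq_trans (\sum_(c <- A) (c == d))); last first.
  by rewrite sum_eq_uniq //; case: (_ \in _).
apply: leq_sum => c _; rewrite xpair_eqE /= /d.
have [x0 y0 z0] := nzr _ tr.
have [E|//] := eqVneq (t.1.2 * c / (t.1.1 * t.2))%R (t'.1.2 * c' / (t'.1.1 * t'.2))%R.
rewrite -E e eqxx -mulrA; case: eqP => //=; case; field.
by apply/and3P; split.
Qed.

(** * Duality and incidences with G x G *)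

(* G contains the reciprocals of the axis intercepts of the line through (c, b)
   and (d, a). *)
Definition intercept_closed (R : realFieldType) (A G : seq R) : Prop :=
  forall a b c d : R, a \in A -> b \in A -> c \in A -> d \in A ->
    c != d -> a != b -> (a * c != d * b)%R ->
    ((a - b) / (a * c - d * b) \in G)%R /\ ((c - d) / (a * c - d * b) \in G)%R.

Lemma leq_sum_seq1 (T : eqType) (s : seq T) (x : T) (F : T -> nat) :
  uniq s -> x \in s -> F x <= \sum_(y <- s) F y.
Proof. by move=> us xs; rewrite (bigD1_seq x) //= leq_addr. Qed.

(** The line through [p] and [q] is neither vertical nor horizontal and misses the origin. *)
Definition general_position (R : realFieldType) (p q : R * R) : bool :=
  [&& p.1 != q.1, q.2 != p.2 & (q.2 * p.1 != q.1 * p.2)%R].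

(** For fixed [p], each of the three conditions fails for at most [size A] points [q]. *)
Lemma general_position_count (R : realFieldType) (A : seq R) :
  uniq A -> 0%R \notin A ->
  size A ^ 4 <= \sum_(p <- pairs A A) \sum_(q <- pairs A A)
    general_position p q + 3 * size A ^ 3.
Proof.
move=> uA A0; set N := size A.
have -> : N ^ 4 = \sum_(p <- pairs A A) N ^ 2.
  by rewrite sum_const_seq size_pairs -/N; ring.
have -> : 3 * N ^ 3 = \sum_(p <- pairs A A) (3 * N).
  by rewrite sum_const_seq size_pairs -/N; ring.
rewrite -big_split /= big_seq [leqRHS]big_seq.
apply: leq_sum => -[c b] /allpairsP[[c' b'] /= [cA bA [-> ->]]].
have c0 : c' != 0%R by apply: contraNneq A0 => <-.
have le1 x : \sum_(y <- A) (y == x) <= 1 by rewrite sum_eq_uniq // leq_b1.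
apply: (@leq_trans (\sum_(d <- A) \sum_(a <- A)
  (general_position (c', b') (d, a) +
   ((d == c') + (a == b') + (a == d * b' / c')%R)))).
  rewrite (_ : N ^ 2 = \sum_(d <- A) \sum_(a <- A) 1); last first.
    by rewrite sum_const_seq sum1_size.
  apply: leq_sum => d _; apply: leq_sum => a _; rewrite /general_position /=.
  rewrite [c' == d]eq_sym; case: (d == c') => //; case: (a == b') => //=.
  have [|ne] := eqVneq (a * c')%R (d * b')%R => //= E.
  by rewrite -E mulfK // eqxx.
rewrite sum_pairs; under eq_bigr do rewrite big_split /=.
rewrite big_split leq_add2l /=.
under eq_bigr do rewrite !big_split /=; rewrite !big_split /=.
have -> : 3 * N = N + N + N by ring.
rewrite !leq_add //.
- under eq_bigr do rewrite sum_const_seq; rewrite -big_distrr /= -[leqRHS]muln1.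
  by rewrite leq_mul2l le1 orbT.
- by rewrite /N -[leqRHS]muln1 -sum_const_seq; apply: leq_sum.
- by rewrite /N -[leqRHS]muln1 -sum_const_seq; apply: leq_sum.
Qed.

Lemma eq_divr (R : fieldType) (x y z : R) :
  y != 0%R -> (x == z / y)%R = (z == x * y)%R.
Proof. by move=> y0; rewrite -(can2_eq (divfK y0) (mulfK y0)) eq_sym. Qed.

Lemma divr_eq_swap (R : fieldType) (x y z : R) :
  x != 0%R -> y != 0%R -> (z / x == y)%R = (x == z / y)%R.
Proof.
move=> x0 y0; rewrite eq_sym !eq_divr // mulrC //.
Qed.

(** For [q = (c, b, X)], the [Y] with [c X + b Y = 1]. *)
Definition dual_line (R : realFieldType) (q : R * R * R) : R :=
  ((1 - q.1.1 * q.2) / q.1.2)%R.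

Definition dual_incidences (R : realFieldType) (A G : seq R) :
    seq (R * R * R) :=
  [seq q <- pairs (pairs A A) G | dual_line q \in G].

(** Each pair in general position lies on a line [X x + Y y = 1] with [X], [Y] in [G]. So these
    lines have a large second moment of incidences with A x A, and the incidence bound makes the
    first moment large too. *)
Lemma dual_incidences_lb (R : realFieldType) (A G : seq R) :
  uniq A -> 0%R \notin A -> uniq G -> 0%R \notin G -> intercept_closed A G ->
  12 <= size A -> size A ^ 4 <= 512 * size (dual_incidences A G).
Proof.
move=> uA A0 uG G0 AG N12; set N := size A in N12 *.
have nzA x : x \in A -> x != 0%R by apply: contraTneq => ->.
have nzG x : x \in G -> x != 0%R by apply: contraTneq => ->.
pose l (X Y : R) : R * R := (- (X / Y), Y^-1)%R.
pose L := [seq l X Y | X <- G, Y <- G].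
have sL (F : R * R -> nat) :
  \sum_(k <- L) F k = \sum_(X <- G) \sum_(Y <- G) F (l X Y).
  by rewrite big_allpairs_dep.
have uL : uniq L.
  apply: allpairs_uniq => // -[X Y] [X' Y'] _.
  move=> /allpairsP[[X1 Y1] /= [_ Y1G [-> ->]]] [e1 /invr_inj e2].
  by move: e1; rewrite e2 => /oppr_inj /(mulIf (invr_neq0 (nzG _ Y1G))) ->.
pose e (X Y : R) (p : R * R) : bool := p.2 == line_at (l X Y) p.1.
have incE X Y : incidences A A (l X Y) = \sum_(p <- pairs A A) e X Y p.
  by rewrite sum_pairs; apply: eq_bigr => c _; rewrite -(sum_eq_uniq _ uA).
have LI : \sum_(k <- L) incidences A A k = size (dual_incidences A G).
  rewrite sL /dual_incidences size_filter -sum_rel_pred sum_pairs.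
  rewrite [RHS]exchange_big /=; apply: eq_bigr => X _.
  under eq_bigr do rewrite incE.
  rewrite exchange_big /= big_seq [RHS]big_seq.
  apply: eq_bigr => -[c b] /allpairsP[[c' b'] /= [cA bA [-> ->]]].
  rewrite -(sum_eq_uniq _ uG) [LHS]big_seq [RHS]big_seq.
  apply: eq_bigr => Y /nzG Y0; have b0 := nzA _ bA; congr nat_of_bool.
  rewrite /e /dual_line /line_at /=.
  have -> : (- (X / Y) * c' + Y^-1 = (1 - c' * X) / Y)%R by field.
  by rewrite eq_sym divr_eq_swap.
have good : \sum_(p <- pairs A A) \sum_(q <- pairs A A) general_position p q <=
    \sum_(k <- L) incidences A A k ^ 2.
  rewrite sL; under [leqRHS]eq_bigr do
    under eq_bigr do rewrite incE -mulnn big_distrlr /=.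
  under [leqRHS]eq_bigr do rewrite exchange_big /=.
  rewrite [leqRHS]exchange_big /= big_seq [leqRHS]big_seq.
  apply: leq_sum => p pA; under [leqRHS]eq_bigr do rewrite exchange_big /=.
  rewrite [leqRHS]exchange_big /= big_seq [leqRHS]big_seq.
  apply: leq_sum => q qA.
  case/allpairsP: pA => -[c b] /= [cA bA ->].
  case/allpairsP: qA => -[d a] /= [dA aA ->].
  case: (boolP (general_position _ _)) => //= /and3P[/= cd ab acdb].
  have [XG YG] := AG _ _ _ _ aA bA cA dA cd ab acdb.
  apply: leq_trans (leq_sum_seq1 _ uG XG).
  apply: leq_trans (leq_sum_seq1 _ uG YG).
  have D0 : (a * c - d * b != 0)%R by rewrite subr_eq0.
  have C0 : (c - d != 0)%R by rewrite subr_eq0.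
  rewrite /e /line_at /=.
  set X := ((a - b) / _)%R; set Y := ((c - d) / _)%R.
  have Y0 : Y != 0%R by rewrite mulf_neq0 ?invr_neq0.
  have E x : (- (X / Y) * x + Y^-1 = (1 - x * X) / Y)%R by field.
  rewrite !E [b == _]eq_divr // [a == _]eq_divr //.
  have -> : (1 - c * X = b * Y)%R by rewrite /X /Y; field.
  have -> : (1 - d * X = a * Y)%R by rewrite /X /Y; field.
  by rewrite !eqxx.
(* As [N >= 12], at least [3/4 N^4] pairs are in general position; with threshold 64 the error
   [16 N^4] is a third of the resulting [48 N^4]. *)
have := sum_incidences_sqr uA uA (leqnn N) (leqnn N) (isT : 0 < 64) uL.
rewrite LI; set I := size _; set S := (\sum_(k <- L) _ ^ 2) in good *.
have := general_position_count uA A0; rewrite -/N => NJ.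
have N34 : 12 * N ^ 3 <= N ^ 4 by rewrite [N ^ 4]expnS leq_mul2r N12 orbT.
have -> : 4 * 64 ^ 2 * I + 16 * N ^ 4 = 16 * (1024 * I + N ^ 4) by ring.
move: (N ^ 4) (N ^ 3) good NJ N34 => N4 N3.
set J := (\sum_(p <- _) _) => good NJ N34 H; lia.
Qed.

(** Cauchy-Schwarz over the common value [Y]: two dual lines agree at [X] and [X'] exactly when
    [transfer] maps [X] to [X']. *)
Lemma dual_incidences_ub (R : realFieldType) (A G : seq R) :
  uniq A -> 0%R \notin A -> uniq G ->
  size (dual_incidences A G) ^ 2 <= size G *
    \sum_(k <- pairs (pairs (pairs A A) A) A) incidences G G (transfer k).
Proof.
move=> uA A0 uG.
have nzA x : x \in A -> x != 0%R by apply: contraTneq => ->.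
set r := dual_incidences A G.
have rG : {in r, forall q, dual_line q \in G}.
  by move=> q; rewrite mem_filter => /andP[].
apply: leq_trans (size_sqr_fibers uG rG) _.
rewrite leq_mul2l; apply/orP; right.
apply: (@leq_trans (\sum_(q <- pairs (pairs A A) G)
    \sum_(q' <- pairs (pairs A A) G) (dual_line q == dual_line q'))).
  rewrite big_filter big_mkcond; apply: leq_sum => q _; case: ifP => // _.
  by rewrite big_filter big_mkcond; apply: leq_sum => q' _; case: ifP.
(* Both sides are reordered to sum over [c, b, b', c', X], with [X'] innermost on the left. *)
rewrite sum_pairs [leqRHS]sum_pairs [leqRHS]sum_pairs sum_pairs [leqRHS]sum_pairs.
under [leqRHS]eq_bigr do (under eq_bigr do rewrite exchange_big /=;
  rewrite exchange_big /=).
rewrite [leqRHS]exchange_big /=.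
rewrite big_seq [leqRHS]big_seq; apply: leq_sum => c cA.
rewrite big_seq [leqRHS]big_seq; apply: leq_sum => b /nzA b0.
under eq_bigr do rewrite !sum_pairs exchange_big /=.
rewrite exchange_big /= big_seq [leqRHS]big_seq; apply: leq_sum => b' /nzA b'0.
rewrite exchange_big /= big_seq [leqRHS]big_seq; apply: leq_sum => c' /nzA c'0.
apply: leq_sum => X _; rewrite -(sum_eq_uniq _ uG); apply: leq_sum => X' _.
case: eqP => // E; rewrite lt0b; apply/eqP.
have {}E : (1 - c' * X' = (1 - c * X) / b * b')%R.
  by move: E; rewrite /dual_line /= => ->; rewrite divfK.
rewrite /line_at /transfer /cross /=.
apply: (mulfI c'0).
have -> : (c' * X' = 1 - (1 - c * X) / b * b')%R by rewrite -E; ring.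
by field; rewrite b0 c'0.
Qed.

(** * Choice of thresholds *)

Lemma sqrt_floor (N : nat) :
  0 < N -> exists2 s, 0 < s & (s ^ 2 <= N) && (N <= 4 * s ^ 2).
Proof.
move=> N0; have ex : exists s, s ^ 2 <= N by exists 0.
have bnd s : s ^ 2 <= N -> s <= N by apply: leq_trans; rewrite -mulnn; nia.
case: (ex_maxnP ex bnd) => s sN smax.
have s0 : 0 < s by apply: smax; rewrite exp1n.
exists s => //; rewrite sN /=.
have : ~~ (s.+1 ^ 2 <= N) by apply/negP => /smax; rewrite ltnn.
rewrite -ltnNge -!mulnn; nia.
Qed.

(** With [s] about the square root of N, the energy is [<< N^(11/2)]; squaring keeps the bound in
    the naturals. *)
Lemma transfer_energy_sqr (R : realFieldType) (A : seq R) :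
  uniq A -> 0%R \notin A -> 0 < size A ->
  (\sum_(k <- pairs (pairs (pairs A A) A) A)
    \sum_(k' <- pairs (pairs (pairs A A) A) A)
      (transfer k == transfer k')) ^ 2 <= 1600 * size A ^ 11.
Proof.
move=> uA A0 N0; have [s s0 /andP[sN Ns]] := sqrt_floor N0.
have := transfer_energy uA A0; have := cross_energy uA A0 s0 sN.
set W := (\sum_(t <- _) _); set E := (\sum_(k <- _) _).
set N := size A in N0 sN Ns * => sW EW.
have sE : (s * E) ^ 2 <= (20 * N ^ 6) ^ 2.
  rewrite leq_sqr; apply: leq_trans (leq_mul (leqnn s) EW) _.
  by rewrite mulnCA (_ : 20 * N ^ 6 = N * (20 * N ^ 5)) ?leq_mul2l ?sW ?orbT //; ring.
rewrite -(leq_pmul2l N0); apply: leq_trans (leq_mul Ns (leqnn _)) _.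
have -> : 4 * s ^ 2 * E ^ 2 = 4 * (s * E) ^ 2 by ring.
have -> : N * (1600 * N ^ 11) = 4 * (20 * N ^ 6) ^ 2 by ring.
by rewrite leq_mul2l sE orbT.
Qed.

(* The threshold s = N^4 / (8 k^2 n) makes the contribution of the poor lines at
   most half of the lower bound for M. *)
Lemma optimise_threshold (N n M E I k : nat) :
  0 < N -> 0 < n -> 0 < k -> N ^ 4 <= k * I -> I ^ 2 <= n * M ->
  E ^ 2 <= 1600 * N ^ 11 ->
  (forall s, 0 < s -> exists2 m, M <= 4 * s * N ^ 4 + m &
     s * m ^ 2 <= E * (16 * n ^ 4)) ->
  N ^ 29 <= ((8 * k ^ 2) ^ 14 + 1600 * (1024 * k ^ 6) ^ 2) * n ^ 14.
Proof.
move=> N0 n0 k0 NI IM E2 rich; rewrite mulnDl.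
have d0 : 0 < 8 * k ^ 2 * n by rewrite !muln_gt0 ?expn_gt0 k0 n0.
set d := 8 * k ^ 2 * n in d0.
pose s := N ^ 4 %/ d.
(* If [s = 0], then [N ^ 4 <= d], so already [N ^ 29 <= N ^ 56 <= d ^ 14]. *)
case: (posnP s) => [s0|s0].
  have Nd : N ^ 4 <= d.
    by apply/ltnW; rewrite -[d]mul1n -ltn_divLR // -/s s0.
  apply: leq_trans (leq_addr _ _); rewrite -expnMn -/d.
  apply: leq_trans (_ : (N ^ 4) ^ 14 <= _); last by rewrite leq_exp2r.
  by rewrite -expnM leq_pexp2l.
have [m Mm sm] := rich s s0.
have sd : s * d <= N ^ 4 by apply: leq_divM.
have Nsd : N ^ 4 <= 2 * (s * d).
  have : N ^ 4 < s.+1 * d by apply: ltn_ceil.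
  have : d <= s * d by rewrite leq_pmull.
  rewrite mulSn; lia.
have h1 : N ^ 8 <= k ^ 2 * (n * M).
  rewrite (_ : N ^ 8 = (N ^ 4) ^ 2); last by ring.
  apply: leq_trans (_ : (k * I) ^ 2 <= _); first by rewrite leq_sqr.
  by rewrite expnMn leq_mul2l IM orbT.
have h2 : N ^ 8 <= 2 * k ^ 2 * n * m.
  have : 2 * (k ^ 2 * (n * M)) <= 2 * (k ^ 2 * (n * (4 * s * N ^ 4 + m))).
    by rewrite !leq_mul2l Mm !orbT.
  have -> : 2 * (k ^ 2 * (n * (4 * s * N ^ 4 + m))) =
     s * d * N ^ 4 + 2 * k ^ 2 * n * m by rewrite /d; ring.
  have : s * d * N ^ 4 <= N ^ 8.
    by rewrite (_ : N ^ 8 = N ^ 4 * N ^ 4) ?leq_mul2r ?sd ?orbT //; ring.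
  lia.
(* Multiplying [Nsd] by the square of [h2] produces [s * m ^ 2], which [sm] bounds. *)
have h3 : N ^ 20 <= 1024 * k ^ 6 * E * n ^ 7.
  have -> : N ^ 20 = N ^ 4 * (N ^ 8) ^ 2 by ring.
  have h4 : (N ^ 8) ^ 2 <= (2 * k ^ 2 * n * m) ^ 2 by rewrite leq_sqr.
  apply: leq_trans (leq_mul Nsd h4) _.
  have -> : 2 * (s * d) * (2 * k ^ 2 * n * m) ^ 2 =
    64 * k ^ 6 * n ^ 3 * (s * m ^ 2) by rewrite /d; ring.
  have -> : 1024 * k ^ 6 * E * n ^ 7 = 64 * k ^ 6 * n ^ 3 * (E * (16 * n ^ 4)).
    by ring.
  by rewrite leq_mul2l sm orbT.
apply: leq_trans (leq_addl _ _).
(* Squaring [h3] and inserting [E2] leaves a factor [N ^ 11] to cancel from [N ^ 40]. *)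
have N11 : 0 < N ^ 11 by rewrite expn_gt0 N0.
rewrite -(leq_pmul2l N11).
have -> : N ^ 11 * N ^ 29 = (N ^ 20) ^ 2 by ring.
apply: leq_trans (_ : (1024 * k ^ 6 * E * n ^ 7) ^ 2 <= _).
  by rewrite leq_sqr.
have -> : (1024 * k ^ 6 * E * n ^ 7) ^ 2 =
  E ^ 2 * ((1024 * k ^ 6) ^ 2 * n ^ 14) by ring.
have -> : N ^ 11 * (1600 * (1024 * k ^ 6) ^ 2 * n ^ 14) =
  1600 * N ^ 11 * ((1024 * k ^ 6) ^ 2 * n ^ 14) by ring.
by rewrite leq_mul2r E2 orbT.
Qed.

Lemma intercept_closed_lb :
  exists C : nat, forall (R : realFieldType) (A G : seq R) (n : nat),
    uniq A -> 0%R \notin A -> uniq G -> 0%R \notin G ->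
    intercept_closed A G -> size G <= n -> 0 < n ->
    size A ^ 29 <= C * n ^ 14.
Proof.
have small (N0 N n : nat) : N < N0 -> 0 < n -> N ^ 29 <= N0 ^ 29 * n ^ 14.
  move=> NN0 n0; apply: leq_trans (leq_pmulr _ _); last by rewrite expn_gt0 n0.
  by rewrite leq_exp2r // ltnW.
(* The constants 512 and 12 ^ 29 are generalised so that they are not unfolded. *)
have k0 : 0 < 512 by [].
have c12 (N : nat) : (N < 12) || (12 <= N) by case: ltnP.
move: small => /(_ 12); move: k0 c12 (@dual_incidences_lb).
move: 512 => k k0 c12 lb; move: (12 ^ 29) => C0 small.
exists (((8 * k ^ 2) ^ 14 + 1600 * (1024 * k ^ 6) ^ 2) + C0).
move=> R A G n uA A0 uG G0 AG Gn n0.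
case/orP: (c12 (size A)) => NA.
  by apply: leq_trans (small _ _ NA n0) _; rewrite leq_mul2r leq_addl orbT.
apply: leq_trans (leq_mul (leq_addr C0 _) (leqnn _)).
have N0 : 0 < size A by apply: leq_trans NA.
apply: (optimise_threshold N0 n0 k0 (lb _ _ _ uA A0 uG G0 AG NA)).
- apply: leq_trans (dual_incidences_ub uA A0 uG) _.
  exact: leq_mul Gn (leqnn _).
- exact: transfer_energy_sqr.
- move=> s s0.
  have := weighted_incidences (pairs (pairs (pairs A A) A) A)
    (@transfer R) uG uG Gn Gn s0.
  rewrite !size_pairs (_ : _ * _ * _ * _ = size A ^ 4); last by ring.
  by [].
Qed.

(** * Passage to the quotient set and real exponents *)

Local Open Scope ring_scope.
Local Open Scope fset_scope.

Lemma quotient_set_gt0 (R : realType) (A : {fset R}) :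
  (1 < #|` A|)%N -> (0 < #|` quotient_set A|)%N.
Proof.
have mA z : (z \in A) = (z \in enum_fset A) by [].
have uA := fset_uniq A; case E : (enum_fset A) uA => [|x [|y s]] //=.
rewrite inE negb_or => /andP[/andP[xy _] _] _.
have [xA yA] : x \in A /\ y \in A by rewrite !mA E !inE !eqxx orbT.
rewrite cardfs_gt0; apply/fset0Pn; exists ((x * x - y * x) / (x - y)).
by apply/quotient_setP; exists x, x, x, y.
Qed.

(** Removing 0 from a set of at least two elements keeps at least half of it, whence the factor
    [2 ^ 29]. *)
Lemma quotient_set_lb (R : realType) (C : nat) :
  (forall (A G : seq R) (n : nat),
    uniq A -> 0%R \notin A -> uniq G -> 0%R \notin G ->
    intercept_closed A G -> size G <= n -> 0 < n ->
    size A ^ 29 <= C * n ^ 14)%N ->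
  forall A : {fset R}, #|` A| != 1%N ->
    (#|` A| ^ 29 <= 2 ^ 29 * C * #|` quotient_set A| ^ 14)%N.
Proof.
move=> lb A A1.
have [->|An0] := posnP #|` A|; first by rewrite exp0n.
have {A1 An0}A2 : (1 < #|` A|)%N by lia.
have uA := fset_uniq A; have uQ := fset_uniq (quotient_set A).
pose nz (s : seq R) := [seq x : R <- s | x != 0].
pose G := map (@GRing.inv R) (nz (quotient_set A)).
have mem_nz s x : (x \in nz s) = (x != 0) && (x \in s) by rewrite mem_filter.
have GQ : (size G <= #|` quotient_set A|)%N by rewrite size_map size_filter count_size.
have A0 : (#|` A| <= 2 * size (nz A))%N.
  rewrite /nz size_filter.
  have := count_predC (pred1 (0 : R)) A; rewrite (count_uniq_mem _ uA).
  have -> : count (predC (pred1 (0 : R))) A = count (fun x => x != 0%R) A by [].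
  by move: (count _ _) A2 => m; case: (_ \in _) => /=; lia.
have GA : intercept_closed (nz A) G.
  move=> a b c d; rewrite !mem_nz => /andP[_ aA] /andP[_ bA] /andP[_ cA] /andP[_ dA].
  move=> cd ab acdb.
  have D0 : a * c - d * b != 0 by rewrite subr_eq0.
  have C0 : c - d != 0 by rewrite subr_eq0.
  have B0 : a - b != 0 by rewrite subr_eq0.
  (* Swapping the coordinates of both points exchanges the two intercepts, so both have the form
     defining the quotient set. *)
  split; rewrite -[X in X \in _]invrK invf_div; apply: map_f;
    rewrite mem_nz mulf_neq0 ?invr_neq0 //=; apply/quotient_setP.
    by exists c, d, a, b; rewrite [c * a]mulrC [b * d]mulrC.
  by exists a, b, c, d.
have Q0 : (0 < #|` quotient_set A|)%N.
  exact: quotient_set_gt0.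
have := lb (nz A) G _ _ _ _ _ GA GQ Q0.
rewrite !filter_uniq // map_inj_uniq; last exact: invr_inj.
rewrite filter_uniq // mem_nz eqxx => /(_ isT isT isT) => H.
apply: (@leq_trans ((2 * size (nz A)) ^ 29)%N); first by rewrite leq_exp2r.
rewrite expnMn -mulnA leq_mul2l H ?orbT //.
by apply/mapP => -[x]; rewrite mem_nz => /andP[/negP x0 _] /esym/eqP; rewrite invr_eq0.
Qed.

(** A singleton has an empty quotient set, so the bound fails there; for the empty set both sides
    vanish. *)
Theorem theorem5 (R : realType) :
  exists2 K : R, 0 < K &
    forall A : {fset R}, #|` A| != 1%N ->
      K * (#|` A|%:R `^ (2 + 1 / 14)) <= #|` quotient_set A|%:R.
Proof.
have [C lb] := intercept_closed_lb.
have {lb} := quotient_set_lb (lb R); move: (2 ^ 29 * C)%N => {}C lb.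
(* The successor makes the constant positive even if [C = 0]. *)
have D0 : 0 < C.+1%:R :> R by rewrite ltr0n.
exists (C.+1%:R `^ (1 / 14))^-1; first by rewrite invr_gt0 powR_gt0.
move=> A /lb {lb}; set k := #|` A|; set n := #|` _| => kn.
rewrite ler_pdivrMl ?powR_gt0 //.
have -> : (2 + 1 / 14 = 29%:R * (1 / 14) :> R)%R by field.
rewrite powRrM powR_mulrn ?ler0n //.
have -> : n%:R = (n%:R ^+ 14) `^ (1 / 14) :> R.
  rewrite -powR_mulrn ?ler0n // -powRrM.
  by rewrite (_ : 14%:R * (1 / 14) = 1) ?powRr1 ?ler0n //; field.
rewrite -powRM ?exprn_ge0 ?ler0n //; apply: ge0_ler_powR.
- lra.
- by rewrite nnegrE exprn_ge0 ?ler0n.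
- by rewrite nnegrE mulr_ge0 ?exprn_ge0 ?ler0n.
rewrite -!natrX -natrM ler_nat; apply: leq_trans kn _.
by rewrite leq_mul2r leqnSn orbT.
Qed.
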